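(* Let $p \neq 2$ be a prime and let $e, k \ge 1$ be integers. Let $g \in \mathbb{Z}$ be fixed with $p \nmid g$, and let $m$ be the multiplicative order of $g$ modulo $p$. Then there are exactly $m^k$ rooted closed walks of length $k$ modulo $p^e$ associated with $g$ in $\{1, 2, \ldots, p^e m\}^k$. Furthermore, any two (different) of these rooted closed walks are distinct modulo $p^e$ and distinct modulo $m$ (as $k$-tuples of residue classes).
   Context: For a prime $p$ and $g \in \mathbb{Z}$ with $p \nmid g$, an ordered tuple of integers $(h_1, \ldots, h_k)$ is a rooted closed walk of length $k$ modulo $p^e$ associated with $g$ if the $k$ congruences $g^{h_1} \equiv h_2$, $g^{h_2} \equiv h_3$, $\ldots$, $g^{h_{k-1}} \equiv h_k$, $g^{h_k} \equiv h_1 \pmod{p^e}$ are all satisfied (for $k=1$ this is the single congruence $g^{h_1} \equiv h_1 \pmod{p^e}$). *)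

(* Defs.v *)
From HB Require Import structures.
From mathcomp Require Import all_boot all_order all_algebra all_fingroup.

Set Implicit Arguments.
Unset Strict Implicit.
Unset Printing Implicit Defensive.

Import GRing.Theory.

Local Open Scope ring_scope.

(* The multiplicative order of g modulo p, for p prime not dividing g: the
   order of the class of g in the unit group of 'F_p.  When p divides g the
   class is not a unit and insubd falls back to 1. *)
Definition mulorder (p : nat) (g : int) : nat :=
  #[insubd (1%g : {unit 'F_p}) (g%:~R : 'F_p)]%g.

(* Congruences modulo p ^ e are equalities in 'Z_(p ^ e), which is the ring of
   integers modulo p ^ e as soon as 1 < p ^ e.  The exponents are integers:
   a negative power of g is a power of its inverse in 'Z_(p ^ e).  As ordS is
   the cyclic successor on 'I_k, the last index is followed by the first. *)
Definition rooted_closed_walk (p e : nat) (g : int) (k : nat)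
    (h : k.-tuple int) : bool :=
  [forall i : 'I_k,
     (g%:~R : 'Z_(p ^ e)) ^ tnth h i == (tnth h (ordS i))%:~R].

(* The rooted closed walks in {1, ..., N} ^ k. *)
Definition walks_upto (p e : nat) (g : int) (k N : nat) :
    {set k.-tuple 'I_N.+1} :=
  [set h : k.-tuple 'I_N.+1 |
    [forall i : 'I_k, (0 < tnth h i)%N] &&
    rooted_closed_walk p e g (map_tuple (fun j : 'I_N.+1 => (j : nat)%:Z) h)].

(* Main.v *)
Require Import Defs.
From mathcomp Require Import all_boot all_order all_algebra all_fingroup.
From mathcomp Require Import cyclic.

(** The walks correspond bijectively to the tuples of residues modulo m, of
    which there are m ^ k, by taking each entry modulo m.

    Once the class of the exponent modulo m is fixed, exponentiation to base g
    is a contraction for the p-adic distance: if a and b agree modulo m and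
    modulo p ^ j, then g ^ a and g ^ b agree modulo p ^ (j + 1)
    ([exp_contraction]), because g ^ m is 1 modulo p and each p-th power gains
    one more factor p.  A closed walk with prescribed residues a modulo m is a
    fixed point of the map that sends h to the tuple h' with
    h'_(i+1) = g ^ h_i modulo p ^ e and h'_i = a_i modulo m; this map exists by
    the Chinese remainder theorem, as m is prime to p.  Being a contraction, it
    has at most one fixed point modulo p ^ e ([walk_mod_inj]), and the iterates
    from the starting point a become stationary modulo p ^ e after e steps
    ([walk_mod_exists]).  Since being a walk only depends on the entries modulo
    p ^ e * m ([walk_mod_congr]), the interval of that length contains exactly
    one walk for each tuple of residues modulo m.

    Distinct walks are therefore distinct modulo m.  They are also distinct
    modulo p ^ e: the congruence g ^ h_i = h_(i+1) modulo p shows that the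
    entries modulo p ^ e determine the entries modulo m
    ([walk_mod_eq_period]). *)

Set Implicit Arguments.
Unset Strict Implicit.
Unset Printing Implicit Defensive.

Import GRing.Theory Num.Theory.

Lemma eqn_mod_dvdm (d n a b : nat) :
  d %| n -> a = b %[mod n] -> a = b %[mod d].
Proof. by move=> dn ab; rewrite -(modn_dvdm a dn) ab modn_dvdm. Qed.

Lemma expn_eqmod (n a b c : nat) :
  a = b %[mod n] -> a ^ c = b ^ c %[mod n].
Proof. by move=> ab; rewrite -(modnXm c n a) ab modnXm. Qed.

(** * Powers of an integer modulo powers of a prime *)

(** This says that m is the multiplicative order of G modulo p, in the form in
    which both directions are used: exponents may be reduced modulo m, and can
    be read off modulo m from the power modulo p. *)
Definition exp_period (p G m : nat) : Prop :=
  forall a b, (G ^ a == G ^ b %[mod p]) = (a == b %[mod m]).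

(** By Fermat, G ^ p and G agree modulo p, so that p is 1 modulo m. *)
Lemma exp_period_coprime (p G m : nat) :
  prime p -> exp_period p G m -> coprime m p.
Proof.
move=> p_pr perG.
have : G ^ p == G ^ 1 %[mod p] by rewrite expn1 fermat_little.
rewrite perG => /eqP p1.
by rewrite /coprime -gcdn_modr p1 gcdn_modr gcdn1.
Qed.

(** In X ^ p - 1 = (X - 1)(1 + X + ... + X ^ (p - 1)) the second factor is
    congruent to p modulo p, so it contributes one more factor p. *)
Lemma dvdn_pred_exp_prime (p j X : nat) :
  0 < X -> 0 < j -> p ^ j %| X.-1 -> p ^ j.+1 %| (X ^ p).-1.
Proof.
move=> X0 j0 pX; rewrite predn_exp expnSr dvdn_mul //.
have X1 : X = 1 %[mod p].
  apply/eqP; rewrite eqn_mod_dvd // subn1.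
  by apply: dvdn_trans pX; rewrite -{1}(expn1 p) dvdn_exp2l.
have -> : (p %| \sum_(i < p) X ^ i) = (p %| \sum_(i < p) 1).
  rewrite /dvdn -modn_summ.
  under eq_bigr => i _ do rewrite (expn_eqmod i X1) exp1n.
  by rewrite modn_summ.
by rewrite sum1_card card_ord.
Qed.

Lemma dvdn_pred_exp_primeX (p G m j : nat) :
  0 < G -> exp_period p G m -> p ^ j.+1 %| (G ^ (m * p ^ j)).-1.
Proof.
move=> G0 perG; elim: j => [|j IHj].
  rewrite expn0 muln1 expn1 -subn1 -eqn_mod_dvd ?expn_gt0 ?G0 //.
  by rewrite -(expn0 G) perG modnn mod0n.
rewrite (expnSr p j) mulnA expnM; apply: dvdn_pred_exp_prime => //.
by rewrite expn_gt0 G0.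
Qed.

(** Exponentiation is a contraction on exponents of a fixed class modulo m:
    each application gains one power of p.  The reason is that G ^ (m * p ^ j)
    is 1 modulo p ^ (j + 1). *)
Lemma exp_contraction (p G m j a b : nat) :
    prime p -> 0 < G -> exp_period p G m ->
    a = b %[mod m] -> a = b %[mod p ^ j] ->
  G ^ a = G ^ b %[mod p ^ j.+1].
Proof.
move=> p_pr G0 perG.
wlog le_ba : a b / b <= a => [wl abm abp|].
  by case: (leqP b a) => [|/ltnW] ab; [|symmetry]; apply: wl.
move=> /eqP abm /eqP abp; apply/eqP.
have : m * p ^ j %| a - b.
  rewrite Gauss_dvd ?coprimeXr ?(exp_period_coprime p_pr perG) //.
  by rewrite -!eqn_mod_dvd // abm abp.
case/dvdnP=> c def_c; rewrite -(subnK le_ba) def_c expnD (mulnC c) expnM.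
have G1 : G ^ (m * p ^ j) = 1 %[mod p ^ j.+1].
  apply/eqP; rewrite eqn_mod_dvd ?expn_gt0 ?G0 // subn1.
  exact: dvdn_pred_exp_primeX.
by rewrite -modnMml (expn_eqmod c G1) exp1n modnMml mul1n.
Qed.

(** * Closed walks modulo a prime power *)

Definition walk_mod (q G k : nat) (h : 'I_k -> nat) : Prop :=
  forall i, G ^ h i = h (ordS i) %[mod q].

(** By contraction, agreement modulo p ^ j at a vertex gives agreement modulo
    p ^ (j + 1) at the next one. *)
Lemma walk_mod_inj (p e G m k : nat) (h h' : 'I_k -> nat) :
    prime p -> 0 < G -> exp_period p G m ->
    walk_mod (p ^ e) G h -> walk_mod (p ^ e) G h' ->
    (forall i, h i = h' i %[mod m]) ->
  forall i, h i = h' i %[mod p ^ e].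
Proof.
move=> p_pr G0 perG wh wh' hm.
suff H j : j <= e -> forall i, h i = h' i %[mod p ^ j] by apply: H.
elim: j => [|j IHj] le_je i; first by rewrite !modn1.
have pj : p ^ j.+1 %| p ^ e by rewrite dvdn_exp2l.
rewrite -(ord_predK i) -(eqn_mod_dvdm pj (wh _)) -(eqn_mod_dvdm pj (wh' _)).
by apply: exp_contraction => //; apply: IHj; apply: ltnW.
Qed.

(** A vertex determines its predecessor modulo m, because its class modulo p
    is the power of G to that predecessor. *)
Lemma walk_mod_eq_period (p e G m k : nat) (h h' : 'I_k -> nat) :
    0 < e -> exp_period p G m ->
    walk_mod (p ^ e) G h -> walk_mod (p ^ e) G h' ->
    (forall i, h i = h' i %[mod p ^ e]) ->
  forall i, h i = h' i %[mod m].
Proof.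
move=> e0 perG wh wh' hp i; apply/eqP; rewrite -perG; apply/eqP.
apply: (@eqn_mod_dvdm p (p ^ e)); first by rewrite -{1}(expn1 p) dvdn_exp2l.
by rewrite wh wh'.
Qed.

(** The map iterated here, from the starting point a, is the one whose fixed
    points, up to congruence modulo q and m, are the walks modulo q with
    residues a modulo m. *)
Fixpoint walk_iter (q G m k : nat) (a : 'I_k -> nat) (n : nat) : 'I_k -> nat :=
  if n is n'.+1 then
    fun i => chinese q m (G ^ walk_iter q G m a n' (ord_pred i)) (a i)
  else a.

(** All the iterates agree with a modulo m, so that by contraction the n-th and
    the next one agree modulo p ^ n; the e-th is thus a fixed point. *)
Lemma walk_mod_exists (p e G m k : nat) (a : 'I_k -> nat) :
    prime p -> 0 < G -> exp_period p G m ->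
  exists2 h, walk_mod (p ^ e) G h & forall i, h i = a i %[mod m].
Proof.
move=> p_pr G0 perG; set u := walk_iter (p ^ e) G m a.
have co_pm : coprime (p ^ e) m.
  by rewrite coprimeXl // coprime_sym (exp_period_coprime p_pr perG).
have u_m n i : u n i = a i %[mod m].
  by case: n => [|n] //; rewrite /u /= chinese_modr.
have u_p n i : u n.+1 i = G ^ u n (ord_pred i) %[mod p ^ e].
  by rewrite /u /= chinese_modl.
have u_cauchy n : n <= e -> forall i, u n.+1 i = u n i %[mod p ^ n].
  elim: n => [|n IHn] lt_ne i; first by rewrite !modn1.
  have pn : p ^ n.+1 %| p ^ e by rewrite dvdn_exp2l.
  rewrite (eqn_mod_dvdm pn (u_p _ _)) (eqn_mod_dvdm pn (u_p _ _)).
  by apply: exp_contraction => //; [rewrite !u_m | apply/IHn/ltnW].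
exists (u e) => // i.
by rewrite -(u_cauchy e (leqnn e)) u_p ordSK.
Qed.

(** Whether h is a walk depends only on its class modulo p ^ e * m, because
    this is a period of the powers of G modulo p ^ e; so a walk can be moved
    into any interval of that length. *)
Lemma walk_mod_congr (p e G m k : nat) (h h' : 'I_k -> nat) :
    prime p -> 0 < G -> exp_period p G m ->
    (forall i, h i = h' i %[mod p ^ e * m]) ->
  walk_mod (p ^ e) G h -> walk_mod (p ^ e) G h'.
Proof.
move=> p_pr G0 perG hh' wh i.
have hm j := eqn_mod_dvdm (dvdn_mull _ (dvdnn m)) (hh' j).
have hp j := eqn_mod_dvdm (dvdn_mulr _ (dvdnn (p ^ e))) (hh' j).
rewrite -hp -wh; apply: (@eqn_mod_dvdm _ (p ^ e.+1)).
  by rewrite dvdn_exp2l.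
by symmetry; apply: exp_contraction.
Qed.

(** * Representatives in an interval *)

Lemma eqn_mod_range (N a b : nat) :
  0 < a <= N -> 0 < b <= N -> a = b %[mod N] -> a = b.
Proof.
case: a b => [|a] [|b] //= aN bN /eqP.
by rewrite -[a.+1]addn1 -[b.+1]addn1 eqn_modDr !modn_small // => /eqP->.
Qed.

Lemma eqn_mod_range_exists (N x : nat) :
  0 < N -> exists2 y : 'I_N.+1, 0 < y & y = x %[mod N].
Proof.
move=> N0; case: (posnP (x %% N)) => [x0|x_gt0].
  by exists ord_max => //=; rewrite x0 modnn.
have lt_xN : x %% N < N.+1 by rewrite ltnW // ltnS ltn_pmod.
by exists (Ordinal lt_xN); rewrite //= modn_mod.
Qed.

(** * Residues of an integer base *)

Lemma intr_modz_nat (R : nzRingType) (n : nat) (g : int) :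
  0 < n -> (n%:R = 0 :> R)%R -> (g%:~R = `|(g %% n%:Z)%Z|%N%:R :> R)%R.
Proof.
move=> n0 nR.
rewrite {1}(divz_eq g n) intrD intrM -[X in (_ * X)%R]pmulrn nR mulr0 add0r.
rewrite pmulrn gez0_abs //.
by rewrite modz_ge0 // eqz_nat -lt0n.
Qed.

Lemma exp_period_mulorder (p G : nat) (g : int) :
    prime p -> ~~ (p%:Z %| g)%Z -> (g%:~R = G%:R :> 'F_p)%R ->
  exp_period p G (mulorder p g).
Proof.
move=> p_pr p_g gG a b.
have g_unit : (g%:~R \is a @GRing.unit 'F_p)%R.
  by rewrite unitfE -(dvdz_pcharf (pchar_Fp p_pr)).
rewrite /mulorder; set u := insubd _ _.
have val_u : (val u = G%:R :> 'F_p)%R by rewrite val_insubd g_unit gG.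
rewrite -eq_expg_mod_order -val_eqE !FinRing.val_unitX val_u -!natrX.
by rewrite -val_eqE /= !val_Fp_nat.
Qed.

Lemma rooted_closed_walkP (p e k N G : nat) (g : int)
    (h : k.-tuple 'I_N.+1) :
    1 < p ^ e -> (g%:~R = G%:R :> 'Z_(p ^ e))%R ->
  reflect (walk_mod (p ^ e) G (fun i => tnth h i))
    (rooted_closed_walk p e g (map_tuple (fun j : 'I_N.+1 => Posz j) h)).
Proof.
move=> q1 gG; apply: (iffP forallP) => wh i; move: (wh i).
  rewrite !tnth_map gG -exprnP -natrX -pmulrn => /eqP/(congr1 val) /=.
  by rewrite !val_Zp_nat.
rewrite !tnth_map gG -exprnP -natrX -pmulrn => Gh.
by apply/eqP/val_inj; rewrite /= !val_Zp_nat.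
Qed.

(** * The count *)

Theorem theorem13 (p e k m : nat) (g : int)
    (p_prime : prime p) (p_neq2 : p <> 2)
    (e_ge1 : 1 <= e) (k_ge1 : 1 <= k)
    (p_ndvd_g : ~~ (p%:Z %| g)%Z)
    (m_def : m = mulorder p g) :
  #|walks_upto p e g k (p ^ e * m)| = m ^ k
  /\ (forall h h' : k.-tuple 'I_(p ^ e * m).+1,
        h \in walks_upto p e g k (p ^ e * m) ->
        h' \in walks_upto p e g k (p ^ e * m) ->
        h <> h' ->
        (exists i : 'I_k, tnth h i <> tnth h' i %[mod p ^ e])
        /\ (exists i : 'I_k, tnth h i <> tnth h' i %[mod m])).
Proof.
set q := p ^ e; set N := q * m.
have q1 : 1 < q by rewrite -(exp1n e) ltn_exp2r // prime_gt1.
have q0 : 0 < q by apply: ltnW.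
have m0 : 0 < m by rewrite m_def order_gt0.
have N0 : 0 < N by rewrite muln_gt0 q0.
have pq : p %| q by rewrite -{1}(expn1 p) dvdn_exp2l.
(* One natural number G stands for g both in 'Z_q and in 'F_p, as p divides q. *)
pose G := `|(g %% Posz q)%Z|.
have gZ : (g%:~R = G%:R :> 'Z_q)%R.
  by apply: intr_modz_nat => //; apply: pchar_Zp.
have gF : (g%:~R = G%:R :> 'F_p)%R.
  apply: intr_modz_nat => //; apply/eqP.
  by rewrite -(dvdn_pcharf (pchar_Fp p_prime)).
have perG : exp_period p G m by rewrite m_def; apply: exp_period_mulorder.
have G0 : 0 < G.
  rewrite lt0n; apply: contra p_ndvd_g => /eqP G0.
  by rewrite (dvdz_pcharf (pchar_Fp p_prime)) gF G0.
have co_qm : coprime q m.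
  by rewrite coprimeXl // coprime_sym (exp_period_coprime p_prime perG).
pose W := walks_upto p e g k N.
have inW (h : k.-tuple 'I_N.+1) : reflect ((forall i, 0 < tnth h i) /\
    walk_mod q G (fun i => tnth h i)) (h \in W).
  rewrite inE; apply: (iffP andP) => -[h0 wh].
    by split=> [i|]; [apply: (forallP h0) | apply/(rooted_closed_walkP _ q1 gZ)].
  by split; [apply/forallP | apply/(rooted_closed_walkP _ q1 gZ)].
have range_W h : h \in W -> forall i, 0 < tnth h i <= N.
  by case/inW=> h0 _ i; rewrite h0 -ltnS ltn_ord.
have W_inj h h' : h \in W -> h' \in W ->
    (forall i, tnth h i = tnth h' i %[mod m]) -> h = h'.
  move=> hW h'W hm; have [[_ wh] [_ wh']] := (inW _ hW, inW _ h'W).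
  apply: eq_from_tnth => i; apply/val_inj.
  apply: (@eqn_mod_range N); rewrite ?range_W //.
  apply/eqP; rewrite chinese_remainder //; apply/andP.
  split; apply/eqP; last exact: hm.
  exact: (walk_mod_inj p_prime G0 perG wh wh' hm).
split.
  pose res (h : k.-tuple 'I_N.+1) : k.-tuple 'I_m :=
    [tuple Ordinal (ltn_pmod (tnth h i) m0) | i < k].
  rewrite -/W -(card_in_imset (f := res)); last first.
    move=> h h' hW h'W eq_res; apply: W_inj => // i.
    by move: (congr1 (fun r => val (tnth r i)) eq_res); rewrite !tnth_mktuple.
  suff -> : res @: W = [set: k.-tuple 'I_m].
    by rewrite cardsT card_tuple card_ord.
  apply/setP=> a; rewrite in_setT; apply/imsetP.
  have [h wh ha] := walk_mod_exists e (fun i => tnth a i : nat) p_prime G0 perG.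
  have /fin_all_exists2 [r r0 rh] : forall i : 'I_k,
      exists2 y : 'I_N.+1, 0 < y & y = h i %[mod N].
    by move=> i; apply: eqn_mod_range_exists.
  exists [tuple r i | i < k].
    apply/inW; split=> [i|]; first by rewrite tnth_mktuple.
    apply: (walk_mod_congr p_prime G0 perG _ wh) => i.
    by rewrite tnth_mktuple rh.
  apply: eq_from_tnth => i; apply: val_inj; rewrite !tnth_mktuple /=.
  by rewrite (eqn_mod_dvdm (dvdn_mull _ (dvdnn m)) (rh i)) ha modn_small.
move=> h h' hW h'W neq_hh'; have [[_ wh] [_ wh']] := (inW _ hW, inW _ h'W).
have diff_at d : ~ (forall i, tnth h i = tnth h' i %[mod d]) ->
    exists i : 'I_k, tnth h i <> tnth h' i %[mod d].
  move=> neq; case: (boolP [forall i, tnth h i == tnth h' i %[mod d]]).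
    by move/forallP=> eq_d; case: neq => i; apply/eqP.
  by case/forallPn=> i /eqP; exists i.
split; apply: diff_at => eq_d; apply: neq_hh'; apply: W_inj => //.
exact: (walk_mod_eq_period e_ge1 perG wh wh').
Qed.
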